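(* Let $G=(V,E)$ be an undirected graph with $n=|V|$, $\epsilon\in(0,1]$, $\delta\in(0,1)$, $\epsilon'=\frac{(1-e^{-1})\epsilon}{8\ln(e/\delta)}$, and let $c\ge\frac1{\epsilon'}+1$ be the algorithm's fixed offset constant. Algorithm ParDenseDP: set $S_1=V$, $t=1$; while $S_t\ne\emptyset$, independently select each $j\in S_t$ with probability $\exp(-\epsilon'(\deg_{S_t}(j)+c))$, let $S_{t+1}$ be $S_t$ minus the selected nodes, and increment $t$; finally, among the distinct nonempty sets of the sequence $S_1,S_2,\ldots$, output a set $S$ chosen with probability proportional to $\exp(\epsilon\rho(S)/2)$. Then ParDenseDP is $(\epsilon,\delta)$-differentially private with respect to edge-neighboring graphs.
   Context: $\deg_S(j)$ is the number of neighbors of $j$ in $S$; $\rho(S)=|E(S)|/|S|$ is the density of the subgraph induced by $S$. Graphs on the same vertex set are neighbors if their edge sets differ in exactly one edge. $M$ is $(\epsilon,\delta)$-differentially private if $\Pr[M(G)\in\mathcal{P}]\le e^{\epsilon}\Pr[M(G')\in\mathcal{P}]+\delta$ for all neighbors $G,G'$ and output sets $\mathcal{P}$. *)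

(* Defs.v *)
From mathcomp Require Import all_boot all_order all_algebra.
From mathcomp Require Import all_classical all_reals all_analysis.

Set Implicit Arguments.
Unset Strict Implicit.
Unset Printing Implicit Defensive.

Import Order.TTheory GRing.Theory Num.Theory numFieldNormedType.Exports.

Local Open Scope ring_scope.

Record sgraph (V : finType) := SGraph {
  adj :> rel V;
  adj_sym : symmetric adj;
  adj_irrefl : irreflexive adj }.

Definition edges (V : finType) (G : sgraph V) : {set {set V}} :=
  [set e : {set V} | [exists x, exists y, G x y && (e == [set x; y]%SET)]]%SET.

Definition induced_edges (V : finType) (G : sgraph V) (S : {set V}) :
  {set {set V}} := [set e in edges G | e \subset S]%SET.

Definition deg_in (V : finType) (G : sgraph V) (S : {set V}) (j : V) : nat :=
  #|[set k in S | G j k]%SET|.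

Definition density (R : realType) (V : finType) (G : sgraph V) (S : {set V}) :
  R := #|induced_edges G S|%:R / #|S|%:R.

Definition edge_neighbors (V : finType) (G G' : sgraph V) : Prop :=
  #|(edges G :\: edges G') :|: (edges G' :\: edges G)| = 1%N.

(* [mu] is the probability mass function of a law on the finite type [Y];
   it is valued in [\bar R] so that it can be given by an infinite series. *)
Definition Pr (R : realType) (Y : finType) (mu : Y -> \bar R) (P : {set Y}) :
  \bar R := (\sum_(y in P) mu y)%E.

(* [M x] is the probability mass function of the output of the mechanism on
   input [x]. *)
Definition differentially_private (R : realType) (X : Type) (Y : finType)
    (nbr : X -> X -> Prop) (M : X -> Y -> \bar R) (eps delta : R) : Prop :=
  forall x x' : X, nbr x x' -> forall P : {set Y},
    (Pr (M x) P <= (expR eps)%:E * Pr (M x') P + delta%:E)%E.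

Section ParDenseDP.
Variables (R : realType) (V : finType) (G : sgraph V) (eps eps' c : R).
Implicit Types (S U : {set V}) (s : seq {set V}) (C : {set {set V}}).

Definition select_prob S (j : V) : R :=
  expR (- (eps' * ((deg_in G S j)%:R + c))).

(* Probability that, selecting the nodes of [S] independently, the selected
   nodes are exactly those of [U], for [U \subset S]. *)
Definition selection_prob S U : R :=
  (\prod_(j in U) select_prob S j) * \prod_(j in S :\: U) (1 - select_prob S j).

Definition step_prob S S' : R :=
  \sum_(U in powerset S | S :\: U == S') selection_prob S U.

Fixpoint path_prob S s : R :=
  if s is S' :: s' then step_prob S S' * path_prob S' s' else 1.

(* [S :: s] is the sequence of sets of a complete execution of the loop from
   [S]: the last set is empty, and no earlier one is. *)
Definition terminated S s : bool :=
  (last S s == finset.set0) && (finset.set0 \notin belast S s).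

Definition candidates s : {set {set V}} := [set S in s | S != finset.set0]%SET.

Definition exp_mech_weight S : R := expR (eps * density R G S / 2).

Definition exp_mech C S : R :=
  if S \in C then exp_mech_weight S / \sum_(S' in C) exp_mech_weight S' else 0.

(* The law of the output set. The sum is over all finite terminated executions,
   grouped by the number [t] of rounds; [s] lists the sets after the first one.
   The loop terminates almost surely, so the total mass is 1: see
   [Pr_ParDenseDP_setT]. *)
Definition ParDenseDP S : \bar R :=
  let S1 := [set: V]%SET in
  (\sum_(0 <= t <oo)
     (\sum_(s : t.-tuple {set V} | terminated S1 s)
        path_prob S1 s * exp_mech (candidates (S1 :: s)) S)%R%:E)%E.

End ParDenseDP.

Section ParDenseDP_total_mass.
Variables (R : realType) (V : finType) (G : sgraph V) (eps eps' c : R).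
Hypotheses (eps'_gt0 : 0 < eps') (c_gt0 : 0 < c).
Implicit Types (S U : {set V}) (s : seq {set V}) (C : {set {set V}}).

Local Notation p := (select_prob G eps' c).
Local Notation step := (step_prob G eps' c).
Local Notation path_pr := (path_prob G eps' c).

Let p_gt0 S j : 0 < p S j.
Proof. exact: expR_gt0. Qed.

Let p_lt1 S j : p S j < 1.
Proof. by rewrite expR_lt1 oppr_lt0 mulr_gt0// ltr_wpDl. Qed.

Let sel_ge0 S U : 0 <= selection_prob G eps' c S U.
Proof.
by apply: mulr_ge0; apply: prodr_ge0 => j _; rewrite ?subr_ge0 ltW.
Qed.

Let step_ge0 S S' : 0 <= step S S'.
Proof. exact: sumr_ge0. Qed.

Let sum_selection S : \sum_(U in powerset S) selection_prob G eps' c S U = 1.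
Proof.
pose F j := if j \in S then p S j else 0.
pose F' j := if j \in S then 1 - p S j else 1.
have -> : 1 = \prod_j (F j + F' j).
  by rewrite big1// => j _; rewrite /F /F'; case: ifP => _; rewrite ?add0r// addrC subrK.
rewrite bigA_distr [RHS](bigID (fun U => U \in powerset S))/= [X in _ = _ + X]big1.
  rewrite addr0; apply: eq_bigr => U; rewrite powersetE => US.
  rewrite [RHS](bigID (mem U))/= /selection_prob; congr (_ * _).
    by apply: eq_bigr => j jU; rewrite jU /F (fintype.subsetP US).
  rewrite [RHS](bigID (mem S))/= [X in _ = _ * X]big1 ?mulr1.
    apply: eq_big => j; first by rewrite finset.inE.
    by rewrite finset.inE => /andP[/negPf -> jS]; rewrite /F' jS.
  by move=> j /andP[/negPf -> /negPf jS]; rewrite /F' jS.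
move=> U; rewrite powersetE => /subsetPn[j jU jS].
by rewrite (bigD1 j)//= jU /F (negPf jS) mul0r.
Qed.

Let sum_step S : \sum_S' step S S' = 1.
Proof.
by rewrite -(sum_selection S) [RHS](partition_big (fun U => S :\: U) predT).
Qed.

Let step_set0_gt0 S : 0 < step S finset.set0.
Proof.
rewrite /step_prob (bigD1 S)/=; last by rewrite powersetE fintype.subxx finset.setDv eqxx.
apply: ltr_pwDl; last exact: sumr_ge0.
apply: mulr_gt0; apply: prodr_gt0 => // j.
by rewrite finset.setDv finset.inE.
Qed.

Let halt t S : R := \sum_(s : t.-tuple {set V} | terminated S s) path_pr S s.
Let alive t S : R :=
  \sum_(s : t.-tuple {set V} | finset.set0 \notin S :: s) path_pr S s.

Let halt0 S : halt 0 S = (S == finset.set0)%:R.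
Proof.
rewrite /halt big_mkcond (big_pred1 [tuple])/=; last by move=> s; rewrite (tuple0 s); apply/esym/eqP.
by rewrite /terminated/= andbT; case: eqP.
Qed.

Let alive0 S : alive 0 S = (S != finset.set0)%:R.
Proof.
rewrite /alive big_mkcond (big_pred1 [tuple])/=; last by move=> s; rewrite (tuple0 s); apply/esym/eqP.
by rewrite inE eq_sym; case: eqP.
Qed.

Let sum_tupleS t (P : pred (seq {set V})) (F : seq {set V} -> R) :
  \sum_(s : t.+1.-tuple {set V} | P s) F s =
  \sum_S \sum_(s : t.-tuple {set V} | P (S :: s)) F (S :: s).
Proof.
rewrite pair_big_dep/=.
rewrite (reindex (fun q : {set V} * t.-tuple {set V} => [tuple of q.1 :: q.2]))//=.
exists (fun s : t.+1.-tuple {set V} => (thead s, [tuple of behead s])) => [[S s] _|s _] /=.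
  by congr pair; apply/val_inj.
by rewrite -tuple_eta.
Qed.

Let haltS t S :
  halt t.+1 S = (S != finset.set0)%:R * \sum_S' step S S' * halt t S'.
Proof.
rewrite /halt (@sum_tupleS _ (terminated S) (path_pr S)) mulr_sumr.
apply: eq_bigr => S' _; rewrite /terminated /=.
case: eqVneq => [->|S0].
  by rewrite mul0r big_pred0// => s; rewrite inE eqxx/= andbF.
rewrite mul1r mulr_sumr; apply: eq_bigl => s.
by rewrite inE [_ == S]eq_sym (negPf S0)/=.
Qed.

Let aliveS t S :
  alive t.+1 S = (S != finset.set0)%:R * \sum_S' step S S' * alive t S'.
Proof.
rewrite /alive (@sum_tupleS _ (fun s => finset.set0 \notin S :: s) (path_pr S)) mulr_sumr.
apply: eq_bigr => S' _; rewrite /=.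
case: eqVneq => [->|S0].
  by rewrite mul0r big_pred0// => s; rewrite inE eqxx.
rewrite mul1r mulr_sumr; apply: eq_bigl => s.
by rewrite [in LHS]inE [_ == S]eq_sym (negPf S0)/=.
Qed.

Let halt_alive k S : \sum_(t < k.+1) halt t S + alive k S = 1.
Proof.
elim: k S => [|k IH] S.
  by rewrite big_ord1 halt0 alive0; case: eqVneq; rewrite (addr0, add0r).
rewrite big_ord_recl halt0 aliveS.
under eq_bigr do rewrite lift0 haltS.
rewrite -mulr_sumr -addrA -mulrDr exchange_big/= -big_split/=.
under eq_bigr do rewrite -mulr_sumr -mulrDr IH mulr1.
by rewrite sum_step mulr1; case: eqVneq; rewrite (addr0, add0r).
Qed.

Let alive_set0 k : alive k finset.set0 = 0.
Proof. by rewrite /alive big_pred0// => s; rewrite inE eqxx. Qed.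

Let path_ge0 S s : 0 <= path_pr S s.
Proof. by elim: s S => //= S' s IH S; apply: mulr_ge0. Qed.

Let r : R := \big[Order.max/0]_S (1 - step S finset.set0).

Let r_ge0 : 0 <= r.
Proof. exact: bigmax_ge_id. Qed.

Let r_lt1 : r < 1.
Proof. by apply/bigmax_ltP; split => // S _; rewrite ltrBlDr ltrDl. Qed.

Let alive_le k S : alive k S <= r ^+ k.
Proof.
elim: k S => [|k IH] S; first by rewrite alive0; case: eqP.
rewrite aliveS; case: eqP => _; first by rewrite mul0r exprn_ge0.
rewrite mul1r (bigD1 finset.set0)//= alive_set0 mulr0 add0r.
apply: (@le_trans _ _ (\sum_(S' | S' != finset.set0) step S S' * r ^+ k)).
  by apply: ler_sum => S' _; rewrite ler_wpM2l.
rewrite -mulr_suml exprS ler_wpM2r ?exprn_ge0//.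
rewrite (_ : \sum_(S' | _) _ = 1 - step S finset.set0); first exact: le_bigmax.
by rewrite -(sum_step S) [X in X - _](bigD1 finset.set0)//= [RHS]addrC addKr.
Qed.

Let halt_ge0 t S : 0 <= halt t S.
Proof. exact: sumr_ge0. Qed.

Let halt_total S : (\sum_(0 <= t <oo) (halt t S)%:E = 1)%E.
Proof.
apply/cvg_lim => //; rewrite -(cvg_shiftS (fun n => \sum_(0 <= t < n) _)%E).
rewrite (_ : (fun n => _) = fun n => (1 - alive n S)%:E); last first.
  apply/funext => n; rewrite sumEFin big_mkord; congr EFin.
  by rewrite -(halt_alive n S) addrK.
apply: cvg_EFin; first by near=> n.
rewrite -[X in (_ --> X)%classic](subr0 (1 : R)); apply: cvgB; first exact: cvg_cst.
apply: (@squeeze_cvgr _ _ _ _ (cst 0) (fun n => r ^+ n)).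
- by near=> n; rewrite alive_le andbT; apply: sumr_ge0.
- exact: cvg_cst.
- by apply: cvg_expr; rewrite ger0_norm.
Unshelve. all: by end_near. Qed.

Let weight_gt0 S : 0 < exp_mech_weight G eps S.
Proof. exact: expR_gt0. Qed.

Let exp_mech_ge0 C S : 0 <= exp_mech G eps C S.
Proof.
rewrite /exp_mech; case: ifP => // _; apply: divr_ge0; first exact: ltW.
by apply: sumr_ge0 => S' _; exact: ltW.
Qed.

Let sum_exp_mech C S : S \in C -> \sum_S' exp_mech G eps C S' = 1.
Proof.
move=> SC; rewrite /exp_mech -big_mkcond/= -mulr_suml divff// gt_eqF//.
rewrite (bigD1 S)//=; apply: ltr_pwDl => //.
by apply: sumr_ge0 => S' _; exact: ltW.
Qed.

(* [V] is nonempty: otherwise there is no candidate to output. *)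
Lemma Pr_ParDenseDP_setT (v : V) :
  Pr (ParDenseDP G eps eps' c) [set: {set V}]%SET = 1%E.
Proof.
rewrite /Pr /ParDenseDP -nneseries_sum; last first.
  move=> S t _; rewrite lee_fin; apply: sumr_ge0 => s _; exact: mulr_ge0.
rewrite -[RHS](halt_total [set: V]%SET); apply: eq_eseriesr => t _.
rewrite sumEFin; congr EFin; rewrite exchange_big/=; apply: eq_bigr => s _.
rewrite -mulr_sumr (eq_bigl predT); last by move=> S; rewrite finset.inE.
rewrite (@sum_exp_mech _ [set: V]%SET) ?mulr1// finset.inE mem_head/=.
by apply/set0Pn; exists v; rewrite finset.inE.
Qed.

End ParDenseDP_total_mass.

(* Main.v *)
Require Import Defs.
From mathcomp Require Import all_boot all_order all_algebra.
From mathcomp Require Import all_classical all_reals all_analysis.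
From mathcomp Require Import ring lra.

(** Let [H] be [G] plus the edge [uv]. As long as both endpoints are present, the
    selection probability of an endpoint is [p] in [G] and [p * exp (- eps')] in
    [H]; once one endpoint has left, the two loops have the same law. Hence an
    execution is less likely in [H] only through the selection of endpoints,
    which costs at most [exp (2 eps')]. It is more likely in [H] only through
    the rounds survived by both endpoints, at a price exponential in [eps'] times
    the sum of their selection probabilities. Surviving with a sum larger than
    [L = ln (1 / delta)] has probability at most [exp (- L) = delta]; otherwise
    the price is at most [exp (eps / 4)]. The two weights of a set in the final
    exponential mechanism differ by a factor in [[1, exp (eps / 2)]], because
    an edge changes a density by at most 1. *)

Set Implicit Arguments.
Unset Strict Implicit.
Unset Printing Implicit Defensive.

Import Order.TTheory GRing.Theory Num.Theory numFieldNormedType.Exports.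

Local Open Scope ring_scope.

(** * Adding one edge: edge sets, densities, degrees *)

Definition add_edge (V : finType) (G H : sgraph V) (u v : V) : Prop :=
  ~~ G u v /\ forall x y, H x y = G x y || ([set x; y]%SET == [set u; v]%SET).

Lemma mem_edges (V : finType) (G : sgraph V) (x y : V) :
  ([set x; y]%SET \in edges G) = G x y.
Proof.
rewrite finset.inE; apply/existsP/idP => [[a /existsP[b /andP[Gab /eqP E]]]|Gxy].
  have : a \in [set x; y]%SET by rewrite E !finset.inE eqxx.
  have : b \in [set x; y]%SET by rewrite E !finset.inE eqxx orbT.
  have : x \in [set a; b]%SET by rewrite -E !finset.inE eqxx.
  have : y \in [set a; b]%SET by rewrite -E !finset.inE eqxx orbT.
  rewrite !finset.inE.
  do 4![case/orP => /eqP ?]; subst => //; by rewrite adj_sym.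
by exists x; apply/existsP; exists y; rewrite Gxy eqxx.
Qed.

Lemma edges_diff1_add_edge (V : finType) (G H : sgraph V) (e : {set V}) :
  (edges G :\: edges H) :|: (edges H :\: edges G) = [set e]%SET ->
  e \in edges H -> exists u v, add_edge G H u v.
Proof.
move=> De eH; have := eH; rewrite finset.inE.
case/existsP=> u /existsP[v /andP[Huv /eqP Ee]]; exists u, v; subst e.
(* The symmetric difference is a singleton, so membership in the two edge sets disagrees at this
   pair and nowhere else. *)
have De' w : ((w \in edges G) != (w \in edges H)) = (w == [set u; v]%SET).
  move/setP/(_ w) : De; rewrite finset.in_setU !finset.in_setD finset.in_set1 => <-.
  by case: (w \in edges G); case: (w \in edges H).
split=> [|x y].
  by have := De' [set u; v]%SET; rewrite eqxx !mem_edges Huv; case: (G u v).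
have := De' [set x; y]%SET; rewrite -!mem_edges.
case: (eqVneq [set x; y]%SET) => [->|_]; first by rewrite eH orbT.
by rewrite orbF; case: (_ \in edges G); case: (_ \in edges H).
Qed.

(** The neighbor relation is symmetric, but adding and removing an edge have different costs; this
    separates the two cases. *)
Lemma edge_neighborsP (V : finType) (G H : sgraph V) : edge_neighbors G H ->
  (exists u v, add_edge G H u v) \/ (exists u v, add_edge H G u v).
Proof.
move=> /eqP/cards1P[e De].
have : e \in (edges G :\: edges H) :|: (edges H :\: edges G).
  by rewrite De finset.inE.
rewrite finset.inE => /orP[]; rewrite finset.inE => /andP[_ eE].
  by right; apply: edges_diff1_add_edge eE; rewrite finset.setUC De.
by left; apply: edges_diff1_add_edge eE; rewrite De.
Qed.

Section AddEdge.
Variables (R : realType) (V : finType) (G H : sgraph V) (u v : V).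
Hypothesis GH : add_edge G H u v.
Implicit Types (S C : {set V}).

Lemma add_edge_sub x y : G x y -> H x y.
Proof. by case: GH => _ -> ->. Qed.

Lemma add_edge_neq : u != v.
Proof.
by apply/eqP => uv; case: GH => _ /(_ u v); rewrite eqxx orbT uv adj_irrefl.
Qed.

Lemma add_edge_sym : add_edge G H v u.
Proof.
case: GH => Guv E; split=> [|x y]; first by rewrite adj_sym.
by rewrite E (finset.setUC [set v]%SET).
Qed.

Lemma edges_add_edge : edges H = ([set u; v] |: edges G)%SET.
Proof.
apply/setP => e; apply/idP/idP.
  rewrite finset.inE => /existsP[x /existsP[y /andP[Hxy /eqP ->]]].
  rewrite finset.inE mem_edges finset.inE.
  by case: GH Hxy => _ -> /orP[->|->]; rewrite ?orbT.
rewrite finset.in_setU1 => /orP[/eqP ->|].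
  by rewrite mem_edges; case: GH => _ ->; rewrite eqxx orbT.
rewrite !finset.inE => /existsP[x /existsP[y /andP[Hxy /eqP ->]]].
by apply/existsP; exists x; apply/existsP; exists y; rewrite add_edge_sub/=.
Qed.

Lemma density_add_edge S : density R G S <= density R H S <= density R G S + 1.
Proof.
rewrite /density; set m := #|S|.
have memE K e : (e \in induced_edges K S) = (e \in edges K) && (e \subset S).
  by rewrite [LHS]finset.inE.
have lb : (#|induced_edges G S| <= #|induced_edges H S|)%N.
  apply: subset_leq_card; apply/fintype.subsetP => e.
  by rewrite !memE edges_add_edge finset.in_setU1 => /andP[-> ->]; rewrite orbT.
have ub : (#|induced_edges H S| <= #|induced_edges G S| + 1)%N.
  apply: (@leq_trans #|([set u; v]%SET |: induced_edges G S)%SET|).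
    apply: subset_leq_card; apply/fintype.subsetP => e.
    rewrite finset.in_setU1 !memE edges_add_edge finset.in_setU1.
    by case/andP => /orP[->|->] ->; rewrite ?orbT.
  by rewrite cardsU1 addnC leq_add2l leq_b1.
rewrite ler_wpM2r ?invr_ge0 ?ler_nat//=.
(* On the empty set both densities are 0, since [0^-1 = 0]; otherwise the extra edge adds at most
   [1 / m <= 1]. *)
have [->|m0] := eqVneq m 0%N; first by rewrite invr0 !mulr0 add0r ler01.
have mp : (0 : R) < m%:R by rewrite ltr0n lt0n.
rewrite ler_pdivrMr// mulrDl mul1r divfK ?gt_eqF// -natrD ler_nat.
by apply: leq_trans ub _; rewrite leq_add2l lt0n.
Qed.

Lemma deg_add_edge_endpoint S : deg_in H S u = (deg_in G S u + (v \in S))%N.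
Proof.
have uv := add_edge_neq; case: GH => Guv HE.
have HuE k : H u k = G u k || (k == v).
  rewrite HE; congr (_ || _); apply/eqP/eqP => [/setP/(_ v)|->//].
  by rewrite !finset.inE eqxx orbT [v == u]eq_sym (negPf uv)/= => /eqP ->.
rewrite /deg_in (cardsD1 v) [X in _ = (X + _)%N](cardsD1 v) !finset.inE HuE.
rewrite (negPf Guv) eqxx andbF andbT add0n addnC; congr (_ + _)%N.
apply: eq_card => k; rewrite !finset.inE HuE.
by case: eqVneq; rewrite ?orbF.
Qed.

Lemma deg_add_edge_other S j : j \notin [set u; v]%SET ->
  deg_in H S j = deg_in G S j.
Proof.
case: GH => _ HE juv; apply: eq_card => k; rewrite !finset.inE HE.
case: eqP => [E|]; last by rewrite orbF.
by move: juv; rewrite -E !finset.inE eqxx.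
Qed.

End AddEdge.

(** * The removal loop on a fixed graph *)

Section Loop.
Variables (R : realType) (V : finType) (G : sgraph V) (eps' c : R).
Implicit Types (S U : {set V}) (s : seq {set V}) (f g : seq {set V} -> R).

Local Notation p := (select_prob G eps' c).
Local Notation step := (step_prob G eps' c).

(** The factor of [j] in the law of one round. The values 0 and 1 outside [S] let the product range
    over all of [V]: it vanishes unless [S'] is a subset of [S]. *)
Definition node_prob S S' (j : V) : R :=
  if j \in S' then if j \in S then 1 - p S j else 0
  else if j \in S then p S j else 1.

(** Only the selection [U = S :\: S'] leads from [S] to [S'], so the sum has at most one term. *)
Lemma step_prob_node S S' : step S S' = \prod_j node_prob S S' j.
Proof.
rewrite /step_prob; have [sub|/subsetPn[j jS' jS]] := boolP (S' \subset S).
  rewrite (big_pred1 (S :\: S')) => [|U /=]; last first.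
    rewrite powersetE; apply/andP/eqP => [[US /eqP <-]|->].
      by rewrite finset.setDDr finset.setDv finset.set0U (finset.setIidPr US).
    by rewrite finset.subsetDl finset.setDDr finset.setDv finset.set0U (finset.setIidPr sub).
  rewrite /selection_prob [RHS](bigID (mem S'))/= mulrC; congr (_ * _).
    apply: eq_big => j.
      rewrite !finset.inE; case: (boolP (j \in S')) => [jS'|].
        by rewrite (fintype.subsetP sub).
      by case: (j \in S).
    rewrite !finset.inE /node_prob; case: (j \in S'); case: (j \in S) => //=.
  rewrite [RHS](bigID (mem S))/= [X in _ = _ * X]big1 ?mulr1.
    apply: eq_big => j; first by rewrite finset.inE.
    by rewrite finset.inE /node_prob => /andP[/negPf -> ->].
  by move=> j /andP[/negPf jS' /negPf jS]; rewrite /node_prob jS' jS.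
rewrite [LHS]big_pred0 => [|U]; last first.
  apply/negbTE/negP => /andP[_ /eqP E]; move: jS'; rewrite -E finset.inE.
  by rewrite (negPf jS) andbF.
by rewrite (bigD1 j)//= /node_prob jS' (negPf jS) mul0r.
Qed.

Lemma step_prob_notsub S S' : ~~ (S' \subset S) -> step S S' = 0.
Proof.
case/subsetPn => j jS' jS.
by rewrite step_prob_node (bigD1 j)//= /node_prob jS' (negPf jS) mul0r.
Qed.

Lemma sum_step_prob S : \sum_S' step S S' = 1.
Proof.
under eq_bigr do rewrite step_prob_node /node_prob.
rewrite -bigA_distr big1// => j _ /=.
by case: ifP => _; rewrite ?add0r ?subrK.
Qed.

Lemma sum_step_prob_both S u v : u \in S -> v \in S -> u != v ->
  \sum_(S' : {set V} | (u \in S') && (v \in S')) step S S' =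
  (1 - p S u) * (1 - p S v).
Proof.
move=> uS vS uv.
pose A j := if j \in S then 1 - p S j else 0.
(* Since [B] is 0 at [u] and [v], expanding the product of the [A j + B j] kills every [S'] that
   misses an endpoint. *)
pose B j := if (j == u) || (j == v) then 0 else if j \in S then p S j else 1.
rewrite (_ : _ * _ = \prod_j (A j + B j)).
  rewrite bigA_distr [RHS](bigID (fun S' => (u \in S') && (v \in S')))/=.
  rewrite [X in _ = _ + X]big1 ?addr0 => [|S'].
    apply: eq_bigr => S' /andP[uS' vS']; rewrite step_prob_node.
    apply: eq_bigr => j _; rewrite /node_prob /A /B.
    case: ifPn => // jS'.
    have /negPf -> : j != u by apply: contraNneq jS' => ->.
    by have /negPf -> : j != v by apply: contraNneq jS' => ->.
  rewrite negb_and => /orP[] /negPf nS'.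
    by rewrite (bigD1 u)//= nS' /B eqxx mul0r.
  by rewrite (bigD1 v)//= nS' /B eqxx orbT mul0r.
rewrite (bigD1 u)//= (bigD1 v)//=; last by rewrite eq_sym.
rewrite big1 ?mulr1; first by rewrite /A /B uS vS !eqxx orbT/= !addr0.
move=> j /andP[/negPf ju /negPf jv]; rewrite /A /B ju jv/=.
by case: ifP; rewrite ?add0r ?subrK.
Qed.

(* The mean of [f], applied to the sets after the first one, over the executions
   that terminate in less than [k] rounds. *)
Definition loop_mean (k : nat) S f : R :=
  \sum_(t < k) \sum_(s : t.-tuple {set V} | terminated S s)
    path_prob G eps' c S s * f s.

Lemma sum_tupleS t (P : pred (seq {set V})) f :
  \sum_(s : t.+1.-tuple {set V} | P s) f s =
  \sum_S \sum_(s : t.-tuple {set V} | P (S :: s)) f (S :: s).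
Proof.
rewrite pair_big_dep/=.
rewrite (reindex (fun q : {set V} * t.-tuple {set V} => [tuple of q.1 :: q.2]))//=.
exists (fun s : t.+1.-tuple {set V} => (thead s, [tuple of behead s])) => [[S s] _|s _] /=.
  by congr pair; apply/val_inj.
by rewrite -tuple_eta.
Qed.

Lemma loop_mean0 S f : loop_mean 0 S f = 0.
Proof. exact: big_ord0. Qed.

(** Conditioning on the first round. Truncating at [k] rounds makes this recursion available for
    induction; [f] sees the whole sequence, so [S'] is put in front of its argument. *)
Lemma loop_meanS k S f : loop_mean k.+1 S f =
  if S == finset.set0 then f [::]
  else \sum_S' step S S' * loop_mean k S' (fun s => f (S' :: s)).
Proof.
rewrite /loop_mean big_ord_recl/=.
rewrite [X in X + _](_ : _ = (S == finset.set0)%:R * f [::]); last first.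
  rewrite big_mkcond (big_pred1 [tuple])/=.
    by rewrite /terminated/= andbT mul1r; case: eqP; rewrite (mul1r, mul0r).
  by move=> s; rewrite (tuple0 s); apply/esym/eqP.
under eq_bigr => t _.
  rewrite /bump/= add1n.
  rewrite (@sum_tupleS _ (terminated S) (fun s => path_prob G eps' c S s * f s)).
  over.
case: eqVneq => [->|S0].
  rewrite mul1r big1 ?addr0// => t _; rewrite big1// => S' _.
  by rewrite big_pred0// => s; rewrite /terminated/= inE eqxx andbF.
rewrite mul0r add0r exchange_big/=; apply: eq_bigr => S' _.
rewrite mulr_sumr; apply: eq_bigr => t _; rewrite mulr_sumr.
apply: eq_big => [s|s _]; last by rewrite mulrA.
by rewrite /terminated/= inE [_ == S]eq_sym (negPf S0).
Qed.

Lemma loop_meanZ k S f (a : R) :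
  loop_mean k S (fun s => a * f s) = a * loop_mean k S f.
Proof.
rewrite /loop_mean mulr_sumr; apply: eq_bigr => t _.
by rewrite mulr_sumr; apply: eq_bigr => s _; rewrite mulrCA.
Qed.

Hypotheses (eps'_gt0 : 0 < eps') (c_gt0 : 0 < c).

Lemma select_prob_gt0 S j : 0 < p S j.
Proof. exact: expR_gt0. Qed.

Lemma select_prob_lt1 S j : p S j < 1.
Proof. by rewrite expR_lt1 oppr_lt0 mulr_gt0// ltr_wpDl. Qed.

Lemma node_prob_ge0 S S' j : 0 <= node_prob S S' j.
Proof.
rewrite /node_prob; do 2!case: ifP => _ //; last by apply/ltW/select_prob_gt0.
by rewrite subr_ge0 ltW// select_prob_lt1.
Qed.

Lemma step_prob_ge0 S S' : 0 <= step S S'.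
Proof. by rewrite step_prob_node; apply: prodr_ge0 => j _; exact: node_prob_ge0. Qed.

Lemma path_prob_ge0 S s : 0 <= path_prob G eps' c S s.
Proof.
elim: s S => //= S' s IH S; apply: mulr_ge0 => //; exact: step_prob_ge0.
Qed.

Lemma loop_mean_ge0 k S f : (forall s, 0 <= f s) -> 0 <= loop_mean k S f.
Proof.
move=> f0; apply: sumr_ge0 => t _; apply: sumr_ge0 => s _.
by rewrite mulr_ge0// path_prob_ge0.
Qed.

Lemma le_loop_mean k S f g : (forall s, f s <= g s) ->
  loop_mean k S f <= loop_mean k S g.
Proof.
move=> fg; apply: ler_sum => t _; apply: ler_sum => s _.
by rewrite ler_wpM2l// path_prob_ge0.
Qed.

Lemma loop_mean_le1 k S f : (forall s, f s <= 1) -> loop_mean k S f <= 1.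
Proof.
elim: k S f => [|k IH] S f f1; first by rewrite loop_mean0 ler01.
rewrite loop_meanS; case: ifP => // _; rewrite -(sum_step_prob S).
by apply: ler_sum => S' _; rewrite ler_piMr ?step_prob_ge0// IH.
Qed.

End Loop.

(** * The loop on two graphs that differ in one edge *)

Lemma expR1V_le2V (R : realType) : (expR 1)^-1 <= 2^-1 :> R.
Proof.
rewrite lef_pV2 ?posrE ?expR_gt0//.
by have := expR_ge1Dx (1 : R); lra.
Qed.

Section LoopAddEdge.
Variables (R : realType) (V : finType) (G H : sgraph V) (u v : V).
Variables (eps' c : R).
Hypothesis GH : add_edge G H u v.
Hypotheses (eps'_gt0 : 0 < eps') (eps'_le : eps' <= 2^-1) (eps'c : 1 <= eps' * c).
Implicit Types (S : {set V}) (s : seq {set V}) (f : seq {set V} -> R).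

Local Notation pG := (select_prob G eps' c).
Local Notation pH := (select_prob H eps' c).
Local Notation stepG := (step_prob G eps' c).
Local Notation stepH := (step_prob H eps' c).
Local Notation meanG := (loop_mean G eps' c).
Local Notation meanH := (loop_mean H eps' c).
Local Notation both S := ((u \in S) && (v \in S)).
Local Notation q := (expR (- eps')).

(** Price per unit of selection probability: [2 * eps'] bounds [exp eps' - 1] when [eps' <= 1/2],
    and [1 - 1/e] is a lower bound for the survival probability of a node. *)
Definition survival_slope : R := 2 * eps' / (1 - (expR 1)^-1).
Local Notation kappa := survival_slope.

Let c_gt0 : 0 < c.
Proof. by rewrite -(pmulr_rgt0 c eps'_gt0); apply: lt_le_trans eps'c. Qed.

Let q_gt0 : 0 < q. Proof. exact: expR_gt0. Qed.

Let q_lt1 : q < 1. Proof. by rewrite expR_lt1 oppr_lt0. Qed.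

Let pG_gt0 S j : 0 < pG S j. Proof. exact: expR_gt0. Qed.

Let pH_gt0 S j : 0 < pH S j. Proof. exact: expR_gt0. Qed.

(** The role of the offset: [eps' * c >= 1] keeps the exponent below -1 whatever the degree. *)
Let pG_le S j : pG S j <= (expR 1)^-1.
Proof.
rewrite -expRN ler_expR lerN2 mulrDr (le_trans eps'c)// lerDr.
by rewrite mulr_ge0// ltW.
Qed.

Let pG_le2V S j : pG S j <= 2^-1.
Proof. exact: le_trans (pG_le S j) (expR1V_le2V R). Qed.

Lemma survival_slope_ge0 : 0 <= kappa.
Proof.
have := expR1V_le2V R; rewrite /kappa => h.
by rewrite divr_ge0//; move: eps'_gt0; lra.
Qed.

Lemma select_prob_endpoints S : both S ->
  pH S u = pG S u * q /\ pH S v = pG S v * q.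
Proof.
move=> /andP[uS vS]; rewrite /select_prob (deg_add_edge_endpoint GH).
rewrite (deg_add_edge_endpoint (add_edge_sym GH)) uS vS /= !addn1 -!natr1 -!expRD.
by split; congr expR; ring.
Qed.

Lemma select_prob_off S j : j \in S -> ~~ both S || (j \notin [set u; v]%SET) ->
  pH S j = pG S j.
Proof.
move=> jS h; rewrite /select_prob; suff -> : deg_in H S j = deg_in G S j by [].
have [|juv] := boolP (j \in [set u; v]%SET); last exact: deg_add_edge_other juv.
move=> juv; move: h; rewrite juv orbF.
move: juv; rewrite !finset.inE => /orP[] /eqP ?; subst j; rewrite jS /= ?andbT => /negPf h.
  by rewrite (deg_add_edge_endpoint GH) h addn0.
by rewrite (deg_add_edge_endpoint (add_edge_sym GH)) h addn0.
Qed.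

Lemma step_prob_off S S' : ~~ both S -> stepH S S' = stepG S S'.
Proof.
move=> h; rewrite !step_prob_node; apply: eq_bigr => j _; rewrite /node_prob.
case: (boolP (j \in S)) => // jS; by rewrite select_prob_off ?h.
Qed.

(** All nodes other than [u] and [v] behave alike in both graphs and form the common factor [r], so
    comparing rounds reduces to two endpoint factors. *)
Lemma step_prob_endpoints S S' : exists r : R, [/\ 0 <= r,
  stepG S S' = node_prob G eps' c S S' u * node_prob G eps' c S S' v * r &
  stepH S S' = node_prob H eps' c S S' u * node_prob H eps' c S S' v * r].
Proof.
have uv := add_edge_neq GH; have vu : v != u by rewrite eq_sym.
exists (\prod_(j | (j != u) && (j != v)) node_prob G eps' c S S' j); split.
- by apply: prodr_ge0 => j _; exact: node_prob_ge0.
- by rewrite step_prob_node (bigD1 u)//= (bigD1 v)//= mulrA.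
- rewrite step_prob_node (bigD1 u)//= (bigD1 v)//= mulrA; congr (_ * _).
  apply: eq_bigr => j /andP[ju jv]; rewrite /node_prob.
  case: (boolP (j \in S)) => // jS; rewrite select_prob_off//.
  by rewrite !finset.inE negb_or ju jv orbT.
Qed.

Lemma step_prob_sub S S' : ~~ both S -> both S' -> stepG S S' = 0.
Proof.
move=> nS /andP[uS' vS']; apply: step_prob_notsub; apply: contra nS.
by move=> /fintype.subsetP sub; rewrite !sub.
Qed.

Lemma loop_mean_off k S f : ~~ both S -> meanH k S f = meanG k S f.
Proof.
elim: k S f => [|k IH] S f nS; first by rewrite !loop_mean0.
rewrite !loop_meanS; case: ifP => // _; apply: eq_bigr => S' _.
(* A departed endpoint never returns: sets containing both endpoints are reached with probability
   0. *)
rewrite step_prob_off//; have [bS'|nS'] := boolP (both S'); last by rewrite IH.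
by rewrite step_prob_sub// !mul0r.
Qed.

Let node_ge0 (K : sgraph V) S S' j : 0 <= node_prob K eps' c S S' j.
Proof. exact: node_prob_ge0. Qed.

Lemma le_survive S S' : both S -> both S' -> stepG S S' <= stepH S S'.
Proof.
move=> bS bS'; have [r [r0 -> ->]] := step_prob_endpoints S S'.
rewrite ler_wpM2r//; have [pu pv] := select_prob_endpoints bS.
move/andP: bS bS' => [uS vS] /andP[uS' vS'].
have := node_ge0 G S S' u; have := node_ge0 G S S' v.
rewrite /node_prob uS vS uS' vS' pu pv => ? ?.
by rewrite ler_pM// lerD2l lerN2 ler_piMr ?ltW.
Qed.

Lemma le_leave S S' : both S -> stepG S S' <= expR (2 * eps') * stepH S S'.
Proof.
move=> bS; have [r [r0 -> ->]] := step_prob_endpoints S S'.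
rewrite mulrA ler_wpM2r//; have [pu pv] := select_prob_endpoints bS.
have -> : expR (2 * eps') = expR eps' * expR eps'.
  by rewrite -expRD; congr expR; ring.
rewrite mulrACA; have E1 : 1 <= expR eps' by rewrite -expR0 ler_expR ltW.
have qE : q * expR eps' = 1 by rewrite -expRD addNr expR0.
(* A surviving endpoint satisfies the bound already with factor 1; a selected one attains
   equality. *)
have key j : j \in S -> pH S j = pG S j * q ->
    node_prob G eps' c S S' j <= expR eps' * node_prob H eps' c S S' j.
  move=> jS pj; rewrite /node_prob jS pj; case: ifP => _.
    apply: (@le_trans _ _ (1 * (1 - pG S j * q))).
      by rewrite mul1r lerD2l lerN2 ler_piMr ?ltW.
    apply: ler_wpM2r => //; rewrite subr_ge0 mulr_ile1 ?ltW//.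
    by apply: le_lt_trans (pG_le2V S j) _; rewrite invf_lt1 ?ltr1n.
  by rewrite mulrCA (mulrC (expR eps')) qE mulr1.
by case/andP: bS => uS vS; apply: ler_pM => //; exact: key.
Qed.

(** The factor is paid once: rounds survived by both endpoints are likelier in [H], the round where
    one leaves costs [expR (2 * eps')], and afterwards the laws agree. *)
Lemma loop_mean_remove_edge k S f : (forall s, 0 <= f s) ->
  meanG k S f <= expR (2 * eps') * meanH k S f.
Proof.
have Q1 : 1 <= expR (2 * eps') by rewrite -expR0 ler_expR mulr_ge0// ltW.
elim: k S f => [|k IH] S f f0; first by rewrite !loop_mean0 mulr0.
have [bS|nS] := boolP (both S); last first.
  by rewrite loop_mean_off// ler_peMl// loop_mean_ge0.
rewrite !loop_meanS; case: ifP => _; first by rewrite ler_peMl.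
rewrite mulr_sumr; apply: ler_sum => S' _.
have [bS'|nS'] := boolP (both S').
  rewrite mulrCA; apply: ler_pM => //; [exact: step_prob_ge0|exact: loop_mean_ge0| |].
    exact: le_survive.
  exact: IH.
rewrite loop_mean_off// mulrA ler_wpM2r ?loop_mean_ge0//.
exact: le_leave.
Qed.

(* The price is exponential in [p * q], the selection probability in the larger
   graph, so that surviving rounds of total price [expR (kappa * x)] has
   probability at most [expR (- x)] there. *)
Lemma survival_ratio p : 0 < p -> p <= (expR 1)^-1 ->
  1 - p * q <= expR (kappa * (p * q)) * (1 - p).
Proof.
move=> p0 pe; set e1 := (expR 1)^-1 in pe.
have e1h : e1 <= 2^-1 by exact: expR1V_le2V.
(* This is [exp eps' <= 1 + 2 * eps']; it uses [eps' <= 1/2] through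
   [(1 - eps') * (1 + 2 * eps') >= 1]. *)
have q1 : 1 <= q * (1 + 2 * eps').
  have : 1 - eps' <= q by exact: expR_ge1Dx.
  move=> ?; apply: (@le_trans _ _ ((1 - eps') * (1 + 2 * eps'))).
    by move: eps'_gt0 eps'_le; nra.
  by rewrite ler_wpM2r//; move: eps'_gt0; lra.
have d0 : 0 < 1 - e1 by move: e1h; lra.
have kE : kappa * (1 - e1) = 2 * eps' by rewrite /kappa divfK// gt_eqF.
(* After linearizing the exponential, it remains to see that
   [p - p * q <= kappa * (p * q) * (1 - p)]; [h1] and [h2] meet at [p * q * (2 * eps')]. *)
apply: (@le_trans _ _ ((1 + kappa * (p * q)) * (1 - p))); last first.
  by apply: ler_wpM2r; [move: pe e1h; lra|exact: expR_ge1Dx].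
have h1 : p <= p * q * (1 + 2 * eps') by rewrite -mulrA ler_peMr// ltW.
have h2 : p * q * (2 * eps') <= kappa * (p * q) * (1 - p).
  rewrite -kE (mulrC kappa) mulrA [kappa * _]mulrC [leRHS]mulrAC.
  apply: ler_wpM2r; first exact: survival_slope_ge0.
  by apply: ler_wpM2l; [rewrite mulr_ge0 ?ltW|rewrite lerD2l lerN2].
by move: h1 h2; lra.
Qed.

Lemma survive_le S S' : both S -> both S' ->
  stepH S S' <= expR (kappa * (pH S u + pH S v)) * stepG S S'.
Proof.
move=> bS bS'; have [r [r0 -> ->]] := step_prob_endpoints S S'.
rewrite mulrA ler_wpM2r//; have [pu pv] := select_prob_endpoints bS.
rewrite mulrDr expRD mulrACA; have := node_ge0 H S S' u; have := node_ge0 H S S' v.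
case/andP: bS bS' => uS vS /andP[uS' vS'].
rewrite /node_prob uS vS uS' vS' pu pv => ? ?.
by apply: ler_pM => //; exact: survival_ratio.
Qed.

(* The loss [q] on the selected endpoint pays for the other one if it survives. *)
Lemma leave_le S S' : both S -> ~~ both S' -> stepH S S' <= stepG S S'.
Proof.
move=> bS bS'; have [r [r0 -> ->]] := step_prob_endpoints S S'.
rewrite ler_wpM2r//; have [pu pv] := select_prob_endpoints bS.
have key a b : 0 < a -> 0 < b -> b <= 2^-1 -> a * q * (1 - b * q) <= a * (1 - b).
  move=> a0 b0 b2; rewrite -mulrA; apply: ler_wpM2l; first exact: ltW.
  (* The second factor is nonnegative because [b <= 1/2] and [1 + q <= 2]. *)
  rewrite -subr_ge0 (_ : _ - _ = (1 - q) * (1 - b * (1 + q))); last by ring.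
  apply: mulr_ge0; rewrite subr_ge0; first exact: ltW.
  have <- : 2^-1 * 2 = 1 :> R by rewrite mulVf.
  apply: ler_pM => //; first exact: ltW.
  by move: q_lt1; lra.
case/andP: bS => uS vS; move: bS'; rewrite /node_prob uS vS pu pv.
case: (u \in S'); case: (v \in S') => //= _.
- by rewrite mulrC [leRHS]mulrC key.
- by rewrite key.
- by apply: ler_pM; rewrite ?mulr_ge0 ?ler_piMr ?ltW.
Qed.

(** The endpoints survive independently, and [1 - y <= exp (- y)] for each. *)
Lemma survival_prob_le S : both S ->
  \sum_(S' : {set V} | both S') stepH S S' <= expR (- (pH S u + pH S v)).
Proof.
case/andP => uS vS; rewrite sum_step_prob_both//; last exact: add_edge_neq GH.
rewrite opprD expRD; apply: ler_pM; rewrite ?subr_ge0 ?expR_ge1Dx//.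
all: exact/ltW/select_prob_lt1.
Qed.

(** Induction on [k] for all [L] at once: [L] is the remaining budget of selection probability, and
    a round survived by both endpoints spends [x] of it. *)
Lemma loop_mean_add_edge k S f L : (forall s, 0 <= f s <= 1) -> 0 <= L ->
  meanH k S f <= expR (kappa * L) * meanG k S f + expR (- L).
Proof.
have k0 := survival_slope_ge0.
have Q1 y : 0 <= y -> 1 <= expR (kappa * y).
  by move=> y0; rewrite -expR0 ler_expR mulr_ge0.
elim: k S f L => [|k IH] S f L f01 L0.
  by rewrite !loop_mean0 mulr0 add0r expR_ge0.
have f0 s : 0 <= f s by case/andP: (f01 s).
have f1 s : f s <= 1 by case/andP: (f01 s).
have [bS|nS] := boolP (both S); last first.
  rewrite loop_mean_off// ler_wpDr ?expR_ge0// ler_peMl ?loop_mean_ge0//.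
  exact: Q1.
rewrite !loop_meanS; case: ifP => _.
  by rewrite ler_wpDr ?expR_ge0// ler_peMl// Q1.
set x := pH S u + pH S v.
have x0 : 0 <= x by rewrite addr_ge0// ltW.
have stH0 S' : 0 <= stepH S S' by exact: step_prob_ge0.
have stG0 S' : 0 <= stepG S S' by exact: step_prob_ge0.
(* Rounds in which an endpoint leaves need no additive error; all of [expR (- L)] is kept for the
   rounds survived by both. *)
rewrite (bigID (fun S' => both S'))/= [in leRHS](bigID (fun S' => both S'))/=.
rewrite mulrDr addrAC; apply: lerD; last first.
  rewrite mulr_sumr; apply: ler_sum => S' nS'; rewrite loop_mean_off//.
  rewrite mulrA ler_wpM2r ?loop_mean_ge0//.
  by apply: le_trans (leave_le bS nS') _; rewrite ler_peMl// Q1.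
(* If this round exhausts the budget, survival alone has probability at most
   [expR (- x) <= expR (- L)]. Otherwise the induction hypothesis applies with budget [L - x]. *)
have [Lx|xL] := leP L x.
  apply: ler_wpDl.
    rewrite mulr_ge0 ?expR_ge0// sumr_ge0// => S' _.
    by rewrite mulr_ge0// loop_mean_ge0.
  apply: (@le_trans _ _ (\sum_(S' : {set V} | both S') stepH S S')).
    by apply: ler_sum => S' _; rewrite ler_piMr// loop_mean_le1.
  by apply: le_trans (survival_prob_le bS) _; rewrite ler_expR lerN2.
apply: (@le_trans _ _ (\sum_(S' : {set V} | both S')
    (expR (kappa * L) * (stepG S S' * meanG k S' (fun s => f (S' :: s))) +
     stepH S S' * expR (- (L - x))))).
  apply: ler_sum => S' bS'.
  have := IH S' (fun s => f (S' :: s)) (L - x).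
  move/(_ (fun s => f01 _)); rewrite subr_ge0 => /(_ (ltW xL)) h.
  apply: le_trans (ler_wpM2l (stH0 S') h) _.
  rewrite mulrDr lerD2r !mulrA ler_wpM2r ?loop_mean_ge0//.
  rewrite (_ : kappa * L = kappa * x + kappa * (L - x)); last by ring.
  rewrite expRD -[leRHS]mulrA [_ * stepG _ _]mulrC mulrA ler_wpM2r ?expR_ge0//.
  exact: survive_le.
rewrite big_split/= -mulr_sumr lerD2l -mulr_suml.
(* The later error [expR (- (L - x))] occurs only after survival, of probability at most
   [expR (- x)]; the product is [expR (- L)]. *)
apply: le_trans (ler_wpM2r (expR_ge0 _) (survival_prob_le bS)) _.
by rewrite -expRD ler_expR /x; lra.
Qed.

End LoopAddEdge.

(** * The final exponential mechanism *)

Section ExpMech.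
Variables (R : realType) (V : finType) (eps : R).
Implicit Types (G H : sgraph V) (S : {set V}) (C P : {set {set V}}).

Lemma exp_mech_ge0 G C S : 0 <= exp_mech G eps C S.
Proof.
rewrite /exp_mech; case: ifP => // _; apply: divr_ge0; first exact: expR_ge0.
by apply: sumr_ge0 => S' _; exact: expR_ge0.
Qed.

Lemma sum_exp_mech_le1 G C P : \sum_(S in P) exp_mech G eps C S <= 1.
Proof.
apply: (@le_trans _ _ (\sum_S exp_mech G eps C S)).
  rewrite [leRHS](bigID (mem P))/= lerDl sumr_ge0// => S _.
  exact: exp_mech_ge0.
rewrite /exp_mech -big_mkcond/= -mulr_suml.
(* The normalizer is 0 only for empty [C], where the total mass is 0 instead of 1. *)
have [->|Z0] := eqVneq (\sum_(S in C) exp_mech_weight G eps S) 0.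
  by rewrite mul0r ler01.
by rewrite divff.
Qed.

(** The weight of [S] contributes the factor [a], the normalizer the factor [b]. *)
Lemma exp_mech_weight_ratio G H (a b : R) C S : 0 <= a -> 0 <= b ->
  (forall S', exp_mech_weight G eps S' <= a * exp_mech_weight H eps S') ->
  (forall S', exp_mech_weight H eps S' <= b * exp_mech_weight G eps S') ->
  exp_mech G eps C S <= a * b * exp_mech H eps C S.
Proof.
move=> a0 b0 GaH HbG; rewrite /exp_mech; case: ifP => SC; last by rewrite mulr0.
have Z0 K : 0 < \sum_(S' in C) exp_mech_weight K eps S'.
  rewrite (bigD1 S)//= ltr_pwDl ?expR_gt0// sumr_ge0// => S' _.
  exact: expR_ge0.
rewrite mulrACA; apply: ler_pM => //; rewrite ?expR_ge0 ?invr_ge0 ?(ltW (Z0 _))//.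
rewrite ler_pdivlMr// mulrC ler_pdivrMr// mulr_sumr.
exact: ler_sum.
Qed.

Lemma exp_mech_weight_add_edge G H (u v : V) S : 0 <= eps -> add_edge G H u v ->
  exp_mech_weight G eps S <= exp_mech_weight H eps S <=
  expR (eps / 2) * exp_mech_weight G eps S.
Proof.
move=> eps0 GH; have /andP[GleH HleG] := density_add_edge R GH S.
rewrite /exp_mech_weight -expRD !ler_expR.
have := ler_wpM2l eps0 GleH; have := ler_wpM2l eps0 HleG; rewrite mulrDr mulr1.
by move=> ? ?; apply/andP; split; lra.
Qed.

(** Adding the edge never lowers a weight, so of weight and normalizer only one costs
    [expR (eps / 2)]. *)
Lemma exp_mech_remove_edge G H (u v : V) C S : 0 <= eps -> add_edge G H u v ->
  exp_mech G eps C S <= expR (eps / 2) * exp_mech H eps C S.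
Proof.
move=> eps0 GH; rewrite -[expR _]mul1r.
apply: exp_mech_weight_ratio => [||S'|S']; rewrite ?expR_ge0 ?mul1r//.
all: by case/andP: (exp_mech_weight_add_edge S' eps0 GH).
Qed.

Lemma exp_mech_add_edge G H (u v : V) C S : 0 <= eps -> add_edge G H u v ->
  exp_mech H eps C S <= expR (eps / 2) * exp_mech G eps C S.
Proof.
move=> eps0 GH; rewrite -[expR _]mulr1.
apply: exp_mech_weight_ratio => [||S'|S']; rewrite ?expR_ge0 ?mul1r//.
all: by case/andP: (exp_mech_weight_add_edge S' eps0 GH).
Qed.

(** The conditional probability that the output lies in [P], given the execution. *)
Definition output_mean G P (s : seq {set V}) : R :=
  \sum_(S in P) exp_mech G eps (candidates ([set: V]%SET :: s)) S.

Lemma output_mean_itv G P s : 0 <= output_mean G P s <= 1.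
Proof.
rewrite sum_exp_mech_le1 andbT sumr_ge0// => S _; exact: exp_mech_ge0.
Qed.

End ExpMech.

(** * From truncated executions to the output law *)

Lemma Pr_ParDenseDP_le (R : realType) (V : finType) (G H : sgraph V)
    (eps eps' c a b : R) (P : {set {set V}}) :
  0 < eps' -> 0 < c -> 0 <= a ->
  (forall k, loop_mean G eps' c k [set: V]%SET (output_mean eps G P) <=
     a * loop_mean H eps' c k [set: V]%SET (output_mean eps H P) + b) ->
  (Pr (ParDenseDP G eps eps' c) P <=
     a%:E * Pr (ParDenseDP H eps eps' c) P + b%:E)%E.
Proof.
move=> e0 c0 a0 le_ab; set T := [set: V]%SET in le_ab *.
pose term K t : R := \sum_(s : t.-tuple {set V} | terminated T s)
  path_prob K eps' c T s * output_mean eps K P s.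
have term_ge0 K t : 0 <= term K t.
  apply: sumr_ge0 => s _; rewrite mulr_ge0 ?path_prob_ge0//.
  by case/andP: (output_mean_itv eps K P s).
have PrE K : Pr (ParDenseDP K eps eps' c) P = (\sum_(0 <= t <oo) (term K t)%:E)%E.
  rewrite /Pr /ParDenseDP -nneseries_sum; last first.
    move=> S t _; rewrite lee_fin; apply: sumr_ge0 => s _.
    by rewrite mulr_ge0 ?path_prob_ge0 ?exp_mech_ge0.
  apply: eq_eseriesr => t _; rewrite sumEFin; congr EFin.
  rewrite exchange_big/=; apply: eq_bigr => s _.
  by rewrite mulr_sumr.
have partE K k : (\sum_(0 <= t < k) (term K t)%:E)%E =
    (loop_mean K eps' c k T (output_mean eps K P))%:E.
  by rewrite sumEFin big_mkord.
have /eqP := PrE G; rewrite eq_le => /andP[leG _].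
have /eqP := PrE H; rewrite eq_le => /andP[_ leH].
apply: le_trans leG _.
apply: (@le_trans _ _ (a%:E * \sum_(0 <= t <oo) (term H t)%:E + b%:E)%E).
  2: by rewrite leeD2r// lee_wpmul2l// lee_fin.
(* Each partial sum for [G] is compared with the same partial sum for [H], which is at most the full
   series since the terms are nonnegative. *)
apply: lime_le.
  by apply: is_cvg_nneseries => t _ _; rewrite lee_fin.
near=> k; rewrite partE.
apply: (@le_trans _ _ (a * loop_mean H eps' c k T (output_mean eps H P) + b)%:E).
  by rewrite lee_fin.
rewrite EFinD EFinM leeD2r// lee_wpmul2l ?lee_fin// -partE.
by apply: nneseries_lim_ge => t _ _; rewrite lee_fin.
Unshelve. all: by end_near. Qed.

(** * Composing the loop with the final choice *)

Section Neighbors.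
Variables (R : realType) (V : finType) (G H : sgraph V) (u v : V).
Variables (eps eps' c : R).
Hypothesis GH : add_edge G H u v.
Hypotheses (eps_ge0 : 0 <= eps).
Hypotheses (eps'_gt0 : 0 < eps') (eps'_le : eps' <= 2^-1) (eps'c : 1 <= eps' * c).
Implicit Types P : {set {set V}}.

Let c_gt0 : 0 < c.
Proof. by rewrite -(pmulr_rgt0 c eps'_gt0); apply: lt_le_trans eps'c. Qed.

Let output_ge0 (K : sgraph V) P s : 0 <= output_mean eps K P s.
Proof. by case/andP: (output_mean_itv eps K P s). Qed.

Lemma Pr_ParDenseDP_remove_edge P :
  (Pr (ParDenseDP G eps eps' c) P <=
   (expR (2 * eps' + eps / 2))%:E * Pr (ParDenseDP H eps eps' c) P)%E.
Proof.
rewrite -[leRHS]adde0; apply: Pr_ParDenseDP_le; rewrite ?expR_ge0// => k.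
rewrite addr0 expRD -mulrA -loop_meanZ.
apply: le_trans (loop_mean_remove_edge GH eps'_gt0 eps'c k _ (output_ge0 G P)) _.
rewrite ler_wpM2l ?expR_ge0//; apply: le_loop_mean => // s.
rewrite mulr_sumr; apply: ler_sum => S _.
exact: exp_mech_remove_edge GH.
Qed.

Lemma Pr_ParDenseDP_add_edge P (L : R) : 0 <= L ->
  (Pr (ParDenseDP H eps eps' c) P <=
   (expR (survival_slope eps' * L + eps / 2))%:E * Pr (ParDenseDP G eps eps' c) P
   + (expR (- L))%:E)%E.
Proof.
move=> L0; apply: Pr_ParDenseDP_le; rewrite ?expR_ge0// => k.
rewrite expRD -mulrA -loop_meanZ.
apply: le_trans (loop_mean_add_edge GH eps'_gt0 eps'_le eps'c k _ (output_mean_itv eps H P) L0) _.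
rewrite lerD2r ler_wpM2l ?expR_ge0//; apply: le_loop_mean => // s.
rewrite mulr_sumr; apply: ler_sum => S _.
exact: exp_mech_add_edge GH.
Qed.

Lemma Pr_ParDenseDP_ge0 (K : sgraph V) P : (0 <= Pr (ParDenseDP K eps eps' c) P)%E.
Proof.
apply: sume_ge0 => S _; apply: nneseries_ge0 => t _ _; rewrite lee_fin.
by apply: sumr_ge0 => s _; rewrite mulr_ge0 ?path_prob_ge0 ?exp_mech_ge0.
Qed.

End Neighbors.

(** * Calibration of the constants *)

Theorem theoremA4 (R : realType) (V : finType) (eps delta eps' c : R)
  (heps0 : 0 < eps) (heps1 : eps <= 1)
  (hdelta0 : 0 < delta) (hdelta1 : delta < 1)
  (heps' : eps' = (1 - (expR 1)^-1) * eps / (8 * ln (expR 1 / delta)))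
  (hc : 1 / eps' + 1 <= c) :
  differentially_private (@edge_neighbors V)
    (fun G : sgraph V => ParDenseDP G eps eps' c) eps delta.
Proof.
(* This budget makes the additive error [expR (- L)] exactly [delta]. *)
pose L := - ln delta.
have L0 : 0 < L by rewrite oppr_gt0 ln_lt0// hdelta0.
have eL : expR (- L) = delta by rewrite opprK lnK.
have lnE : ln (expR 1 / delta) = 1 + L.
  by rewrite ln_div ?posrE ?expR_gt0// expRK.
clearbody L; have e1 := expR1V_le2V R.
have e1_gt0 : 0 < (expR 1)^-1 :> R by rewrite invr_gt0 expR_gt0.
have d0 : 0 < 1 - (expR 1)^-1 :> R by move: e1; lra.
have D0 : 0 < 8 * (1 + L) by move: L0; lra.
rewrite lnE in heps'.
have eps'_gt0 : 0 < eps' by rewrite heps' divr_gt0// mulr_gt0.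
have eps'_le8 : eps' <= eps / 8.
  rewrite heps' ler_pdivrMr// mulrA divfK//.
  by move: L0 heps0 e1_gt0; nra.
have eps'_le : eps' <= 2^-1 by move: eps'_le8 heps1; lra.
have eps'c : 1 <= eps' * c.
  apply: (@le_trans _ _ (eps' * (1 / eps' + 1))); last by rewrite ler_wpM2l// ltW.
  by rewrite mulrDr mulr1 div1r divff ?gt_eqF// lerDl ltW.
have c_gt0 : 0 < c by rewrite -(pmulr_rgt0 c eps'_gt0); apply: lt_le_trans eps'c.
(* The factor [1 - 1/e] in [eps'] cancels the denominator of the slope, leaving
   [(eps / 4) * (L / (1 + L))]. *)
have slope : survival_slope eps' * L <= eps / 4.
  rewrite /survival_slope heps'.
  rewrite (_ : _ * L = eps * L / (4 * (1 + L))); last first.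
    have h2 := expR_ge1Dx (1 : R).
    by field; apply/and3P; split; rewrite gt_eqF//; move: L0 h2; lra.
  rewrite ler_pdivrMr; last by move: L0; lra.
  by move: heps0; lra.
move=> G H GH P.
have hPr K : (0 <= Pr (ParDenseDP K eps eps' c) P)%E by exact: Pr_ParDenseDP_ge0.
(* The exponents are [2 * eps' + eps / 2] and at most [eps / 4 + eps / 2]; both stay below [eps]. *)
case: (edge_neighborsP GH) => -[u [v E]].
  apply: le_trans (Pr_ParDenseDP_remove_edge E (ltW heps0) eps'_gt0 eps'c P) _.
  rewrite -[leLHS]adde0 leeD ?lee_fin ?(ltW hdelta0)//.
  rewrite lee_wpmul2r// lee_fin ler_expR.
  by move: eps'_le8 heps0; lra.
apply: le_trans (Pr_ParDenseDP_add_edge E (ltW heps0) eps'_gt0 eps'_le eps'c P (ltW L0)) _.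
rewrite eL leeD2r// lee_wpmul2r// lee_fin ler_expR.
by move: slope heps0; lra.
Qed.
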